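(* Given integers $k\in\mathbb{N}$ and $\ell,m,n\in\mathbb{N}_{>0}$ and a Mealy machine $T=(S,s_0,\Sigma=\{0,1\}^{\ell},\Lambda\subseteq\{0,1\}^m,t,o)$ such that $2^k<|S|$, the transcription function $\tau_{T,n}$ can be implemented by a $k$-bit hazard-free circuit of size $$O\left(\left(|S|^{3\cdot 2^k}+(2^{\ell}/\ell)\,|S|^{2\cdot 2^k}+2^{\ell}|S|^{2^k}\lambda\right)n\right)$$ and depth $$O\left(2^k\log(|S|)\log n+\ell\right),$$ where $\lambda:=\min\{m,2^{|S|\cdot|\Sigma|}\}$. (The constants hidden in the $O$-notation are absolute.)
   Context: Ternary logic. Let $\mathbb{B}=\{0,1\}$ and $\mathbb{T}=\{0,1,\mathfrak{u}\}$. The basic gates act on $\mathbb{T}$ by Kleene's strong logic: $\mathtt{and}$ outputs $0$ if some input is $0$, $1$ if both inputs are $1$, and $\mathfrak{u}$ otherwise; $\mathtt{or}$ outputs $1$ if some input is $1$, $0$ if both inputs are $0$, and $\mathfrak{u}$ otherwise; $\mathtt{not}(0)=1$, $\mathtt{not}(1)=0$, $\mathtt{not}(\mathfrak{u})=\mathfrak{u}$. A circuit is a combinational (acyclic) circuit of two-input $\mathtt{and}$, two-input $\mathtt{or}$, $\mathtt{not}$, and constant-$0$/constant-$1$ gates; a circuit $C$ with $N$ inputs and $M$ outputs computes a function $C:\mathbb{T}^N\to\mathbb{T}^M$ by induction on its structure. Its size is its number of gates and its depth is the maximal number of gates on a path from input to output. Superposition: for $x,y\in\mathbb{T}$, $x*y=x$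 if $x=y$ and $x*y=\mathfrak{u}$ otherwise; extended componentwise to strings. It is associative and commutative, so the superposition of a nonempty finite set (or family) of strings is defined. Resolution: for $x\in\mathbb{T}^N$, $\mathrm{res}(x)=\{y\in\mathbb{B}^N : x_i\ne\mathfrak{u}\Rightarrow y_i=x_i \text{ for all } i\}$. The hazard-free extension of $f:\mathbb{B}^N\to\mathbb{B}^M$ is $f_{\mathfrak{u}}:\mathbb{T}^N\to\mathbb{T}^M$, where $f_{\mathfrak{u}}(x)$ is the superposition of all $f(y)$, $y\in\mathrm{res}(x)$. A circuit $C$ implements $f$ if $C(x)=f(x)$ for all $x\in\mathbb{B}^N$. A circuit $C$ implementing $f$ is $k$-bit hazard-free if $C(x)=f_{\mathfrak{u}}(x)$ for every $x\in\mathbb{T}^N$ in which $\mathfrak{u}$ appears at most $k$ times. A Mealy machine $T=(S,s_0,\Sigma,\Lambda,t,o)$ consists of a finite set of states $S$, a starting state $s_0\in S$, finite input alphabet $\Sigma$, finite output alphabet $\Lambda$, a state transition function $t:S\times\Sigma\to S$, and an output function $o:S\times\Sigma\to\Lambda$. Its transcription function $\tau_{T,n}:\Sigma^n\to\Lambda^n$ is given by $\tau_{T,n}(x)_i=o(s_{i-1},x_i)$ for $i\in\{1,\dots,n\}$, where $s_i=t(s_{i-1},x_i)$. When $\Sigma=\mathbb{B}^\ell$ and $\Lambda\subseteq\mathbb{B}^m$, $\tau_{T,n}$ is regarded as a Boolean function $\mathbb{B}^{\ell n}\to\mathbb{B}^{mn}$ by concatenating symbols. *)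

(* Defs.v *)
From mathcomp Require Import all_boot all_order all_algebra.
From mathcomp Require Import reals exp.

Set Implicit Arguments.
Unset Strict Implicit.
Unset Printing Implicit Defensive.

(* [Some b] is the stable value b and [None] is the unstable value u. *)
Notation ternary := (option bool).

Notation unstable := (None : ternary).

Definition kleene_and (x y : ternary) : ternary :=
  match x, y with
  | Some false, _ | _, Some false => Some false
  | Some true, Some true => Some true
  | _, _ => None
  end.

Definition kleene_or (x y : ternary) : ternary :=
  match x, y with
  | Some true, _ | _, Some true => Some true
  | Some false, Some false => Some false
  | _, _ => None
  end.

Definition kleene_not (x : ternary) : ternary :=
  if x is Some b then Some (~~ b) else None.

(* A circuit with N inputs is a topologically sorted list of gates.  Wires are *)
(* numbered: wires 0, ..., N - 1 are the inputs and wire N + g is the output   *)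
(* of the g-th gate, whose operands are wires of smaller number.  Wires may be *)
(* read any number of times (unbounded fan-out), also by the circuit outputs.  *)
Inductive gate : Type :=
  | And of nat & nat
  | Or of nat & nat
  | Not of nat
  | Const of bool.

Definition operands (g : gate) : seq nat :=
  match g with
  | And i j | Or i j => [:: i; j]
  | Not i => [:: i]
  | Const _ => [::]
  end.

Fixpoint well_formed (w : nat) (gs : seq gate) : bool :=
  if gs is g :: gs' then all (fun i => i < w) (operands g) && well_formed w.+1 gs'
  else true.

Record circuit (N M : nat) : Type := Circuit {
  gates : seq gate;
  outputs : M.-tuple 'I_(N + size gates);
  gatesP : well_formed N gates
}.

Definition eval_gate (v : seq ternary) (g : gate) : ternary :=
  match g with
  | And i j => kleene_and (nth unstable v i) (nth unstable v j)
  | Or i j => kleene_or (nth unstable v i) (nth unstable v j)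
  | Not i => kleene_not (nth unstable v i)
  | Const b => Some b
  end.

Definition eval_gates (v : seq ternary) (gs : seq gate) : seq ternary :=
  foldl (fun v g => rcons v (eval_gate v g)) v gs.

Definition eval_circuit (N M : nat) (C : circuit N M) (x : N.-tuple ternary) :
    M.-tuple ternary :=
  [tuple nth unstable (eval_gates x (gates C)) (tnth (outputs C) j) | j < M].

Definition circuit_size (N M : nat) (C : circuit N M) : nat := size (gates C).

(* [feeds C v w]: wire w is the output of a gate that reads wire v. *)
Definition feeds (N M : nat) (C : circuit N M) : rel 'I_(N + size (gates C)) :=
  fun v w => (N <= w) && (val v \in operands (nth (Const false) (gates C) (w - N))).

(* A path v :: p starts at an input wire and all wires of p are gate outputs,  *)
(* so that the path contains exactly [size p] gates.                           *)
Definition io_path (N M : nat) (C : circuit N M)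
    (v : 'I_(N + size (gates C))) (p : seq 'I_(N + size (gates C))) : bool :=
  [&& v < N, path (feeds (C := C)) v p & last v p \in outputs C].

(* By [size_io_path] below, bounding d by the number of gates is harmless. *)
Definition circuit_depth (N M : nat) (C : circuit N M) : nat :=
  \max_(d < (size (gates C)).+1 |
        [exists v, exists p : d.-tuple _, io_path (C := C) v p]) d.

Lemma well_formed_nth (gs : seq gate) (w k i : nat) :
  well_formed w gs -> i \in operands (nth (Const false) gs k) -> i < w + k.
Proof.
elim: gs w k => [|g gs IH] w [|k] //= /andP[ops wf].
  by move=> ig; rewrite addn0; exact: (allP ops).
by move=> ig; rewrite addnS -addSn; exact: IH ig.
Qed.

Lemma feeds_lt (N M : nat) (C : circuit N M) v w : feeds (C := C) v w -> v < w.
Proof.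
case/andP=> leNw /(well_formed_nth (gatesP C)).
by rewrite subnKC.
Qed.

Lemma size_io_path (N M : nat) (C : circuit N M) v p :
  io_path (C := C) v p -> size p <= size (gates C).
Proof.
case/and3P=> _ pth _.
have sorted_p : sorted ltn (map val p).
  apply: (@path_sorted _ _ (val v)); rewrite path_map.
  by apply: sub_path pth => a b; exact: feeds_lt.
have uniq_p : uniq (map val p) by exact: sorted_uniq ltn_trans ltnn _ sorted_p.
have sub_p : {subset map val p <= iota N (size (gates C))}; last first.
  by have := uniq_leq_size uniq_p sub_p; rewrite size_map size_iota.
move=> i /mapP[a ap ->].
rewrite mem_iota ltn_ord andbT.
elim: p v pth ap {sorted_p uniq_p} => //= b p IH v /andP[/andP[leNb _] pth].
by rewrite inE => /predU1P[-> //|]; exact: IH pth.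
Qed.

Lemma size_io_path_depth (N M : nat) (C : circuit N M) v p :
  io_path (C := C) v p -> size p <= circuit_depth C.
Proof.
move=> vp; have lt_p : size p < (size (gates C)).+1 by exact: size_io_path vp.
apply: (@bigop.bigmax_sup _ (Ordinal lt_p)) => //=.
by apply/existsP; exists v; apply/existsP; exists (in_tuple p).
Qed.

Definition star (x y : ternary) : ternary := if x == y then x else None.

Definition star_tuple (M : nat) (x y : M.-tuple ternary) : M.-tuple ternary :=
  [tuple star (tnth x j) (tnth y j) | j < M].

(* Only meaningful on nonempty sequences; the order of the terms is irrelevant *)
(* by [star_tupleA] and [star_tupleC].                                         *)
Definition superposition (M : nat) (s : seq (M.-tuple ternary)) : M.-tuple ternary :=
  foldl (@star_tuple M) (head [tuple unstable | _ < M] s) (behead s).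

Lemma star_tupleA (M : nat) : associative (@star_tuple M).
Proof.
move=> x y z; apply: eq_from_tnth => j; rewrite !tnth_mktuple.
by case: (tnth x j) (tnth y j) (tnth z j) => [[]|] [[]|] [[]|].
Qed.

Lemma star_tupleC (M : nat) : commutative (@star_tuple M).
Proof.
move=> x y; apply: eq_from_tnth => j; rewrite !tnth_mktuple.
by case: (tnth x j) (tnth y j) => [[]|] [[]|].
Qed.

Definition stable (N : nat) (x : N.-tuple bool) : N.-tuple ternary :=
  [tuple of map Some x].

Definition resolutions (N : nat) (x : N.-tuple ternary) : {set N.-tuple bool} :=
  [set y : N.-tuple bool |
    [forall i, (tnth x i != unstable) ==> (tnth (stable y) i == tnth x i)]].

Lemma resolutions_neq0 (N : nat) (x : N.-tuple ternary) : resolutions x != set0.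
Proof.
apply/set0Pn; exists [tuple of map (odflt false) x]; rewrite inE.
apply/forallP=> i; apply/implyP; rewrite !tnth_map.
by case: (tnth x i).
Qed.

Definition hazard_free_extension (N M : nat) (f : N.-tuple bool -> M.-tuple bool)
    (x : N.-tuple ternary) : M.-tuple ternary :=
  superposition [seq stable (f y) | y in resolutions x].

Definition implements (N M : nat) (C : circuit N M)
    (f : N.-tuple bool -> M.-tuple bool) : Prop :=
  forall x : N.-tuple bool, eval_circuit C (stable x) = stable (f x).

Definition bit_hazard_free (k N M : nat) (C : circuit N M)
    (f : N.-tuple bool -> M.-tuple bool) : Prop :=
  implements C f /\
  forall x : N.-tuple ternary,
    count_mem unstable x <= k -> eval_circuit C x = hazard_free_extension f x.

Record mealy (Sigma Lambda : finType) : Type := Mealy {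
  state : finType;
  start : state;
  transition : state -> Sigma -> state;
  output : state -> Sigma -> Lambda
}.

Fixpoint transcribe (Sigma Lambda : finType) (T : mealy Sigma Lambda)
    (s : state T) (x : seq Sigma) : seq Lambda :=
  if x is a :: x' then output s a :: transcribe (transition s a) x' else [::].

Lemma size_transcribe (Sigma Lambda : finType) (T : mealy Sigma Lambda) s x :
  size (@transcribe Sigma Lambda T s x) = size x.
Proof. by elim: x s => //= a x IH s; rewrite IH. Qed.

Lemma transcription_subproof (Sigma Lambda : finType) (T : mealy Sigma Lambda)
    (n : nat) (x : n.-tuple Sigma) : size (transcribe (start T) x) == n.
Proof. by rewrite size_transcribe size_tuple. Qed.

Definition transcription (Sigma Lambda : finType) (T : mealy Sigma Lambda)
    (n : nat) (x : n.-tuple Sigma) : n.-tuple Lambda :=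
  Tuple (transcription_subproof T x).

Definition symbols (l n : nat) (x : (l * n).-tuple bool) : n.-tuple (l.-tuple bool) :=
  [tuple [tuple nth false x (i * l + j) | j < l] | i < n].

Lemma concat_subproof (m n : nat) (y : n.-tuple (m.-tuple bool)) :
  size (flatten (map val y)) == m * n.
Proof.
rewrite size_flatten /shape -map_comp sumnE big_map.
under eq_bigr do rewrite /= size_tuple.
by rewrite big_tuple sum_nat_const card_ord mulnC.
Qed.

Definition concat (m n : nat) (y : n.-tuple (m.-tuple bool)) : (m * n).-tuple bool :=
  Tuple (concat_subproof y).

Lemma concatK (m n : nat) : cancel (@concat m n) (@symbols m n).
Proof.
move=> y; apply: eq_from_tnth => i; apply: eq_from_tnth => j.
rewrite !tnth_mktuple /=.
have szy : size (map val y) = n by rewrite size_map size_tuple.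
have shy : shape (map val y) = nseq n m.
  apply: (@eq_from_nth _ 0) => [|a]; first by rewrite size_map szy size_nseq.
  rewrite size_map szy => lt_an; rewrite nth_nseq lt_an.
  rewrite (nth_map [::]) ?szy // (nth_map (nth (tnth y i) y 0)) ?size_tuple //.
have -> : i * m + j = flatten_index (shape (map val y)) i j.
  rewrite /flatten_index shy take_nseq ?(ltnW (ltn_ord i)) //.
  by rewrite sumn_nseq mulnC.
rewrite nth_flatten flatten_indexKl ?flatten_indexKr; last 2 first.
- by rewrite shy nth_nseq ltn_ord.
- by rewrite shy nth_nseq ltn_ord.
rewrite (nth_map (tnth y i)) ?size_tuple //= -!tnth_nth.
by rewrite (tnth_nth false).
Qed.

Definition boolean_transcription (l m : nat) (L : {set m.-tuple bool})
    (T : mealy (l.-tuple bool) {b : m.-tuple bool | b \in L}) (n : nat)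
    (x : (l * n).-tuple bool) : (m * n).-tuple bool :=
  concat [tuple of map val (transcription T (symbols x))].

Definition log2 (R : realType) (x : R) : R := (ln x / ln 2)%R.

(* Main.v *)
(* A state reached with at most k unstable input bits is one of at most        *)
(* K = 2^k possible states, so it is described hazard-freely by the bits       *)
(* [state \in B] for the sets B of at most K states.  Reading input symbol i   *)
(* acts on these bits by the matrix with entries [t(A, x_i) included in B].    *)
(* Kleene's or and and form a distributive lattice, so matrix products over it *)
(* are associative and a parallel prefix circuit computes the same function as *)
(* the sequential product, for which correctness is an induction on i: if the  *)
(* state surely lies in B, the term of the set of all possible states is 1; if *)
(* it surely does not, every term has a factor 0, because the unstable bits of *)
(* symbol i resolve independently of those of the earlier symbols.             *)
(* The matrix entries and output predicates are functions of one symbol.  They *)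
(* are computed by trees of hazard-free multiplexers; sharing all functions of *)
(* the last log2 l - 1 bits reduces their size to O(2^l / l) (Shannon).        *)
Require Import Defs.
From HB Require Import structures.
From mathcomp Require Import all_boot all_order all_algebra.
From mathcomp Require Import zify lra.
From mathcomp Require Import reals exp.

Set Implicit Arguments.
Unset Strict Implicit.
Unset Printing Implicit Defensive.

(** * Kleene algebra and prefix products *)

(** At most [k] unstable bits leave at most [2 ^ k] resolutions, hence at most [2 ^ k] possible
    states at any time ([card_resolutions], [reached_few_unstable]). Gates are monotone in the
    information order, so only output bits on which all resolutions agree have to be checked
    ([bit_hazard_free_stable]).

    Membership of the state in each indexed set forms a row vector. By [block_forall_read], one
    vector-matrix product keeps every determined membership bit stable; the same lemma, with an
    output bit in place of the transition, gives the outputs. By [kleene_mulmxA], regrouping the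
    product changes no value, even on unstable inputs, so [extend_prefix] may evaluate it in
    parallel.

    Let x be |S| to the power 2^k, the number of indices. The prefixes take O(n) matrix products of
    O(x^3) gates. Each of the n x^2 matrix entries takes O(2^l / l) gates once the low multiplexer
    trees are shared, and these shared trees take O(2^l / l) gates per symbol. Outputs take O(2^l)
    gates for each symbol, each index and each of at most lambda distinct output functions. The
    depth is O(l) for the trees plus O(log n) matrix products of depth O(log x) each. *)

Lemma kleene_orA : associative kleene_or.
Proof. by move=> [[]|] [[]|] [[]|]. Qed.

Lemma kleene_orC : commutative kleene_or.
Proof. by move=> [[]|] [[]|]. Qed.

Lemma kleene_or0x : left_id (Some false) kleene_or.
Proof. by case=> [[]|]. Qed.

Lemma kleene_and0x : left_zero (Some false) kleene_and.
Proof. by case=> [[]|]. Qed.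

Lemma kleene_andx0 : right_zero (Some false) kleene_and.
Proof. by case=> [[]|]. Qed.

Lemma kleene_andA : associative kleene_and.
Proof. by move=> [[]|] [[]|] [[]|]. Qed.

Lemma kleene_andDl : left_distributive kleene_and kleene_or.
Proof. by move=> [[]|] [[]|] [[]|]. Qed.

Lemma kleene_andDr : right_distributive kleene_and kleene_or.
Proof. by move=> [[]|] [[]|] [[]|]. Qed.

(** These instances make the generic exchange and distributivity laws for iterated operators apply
    to [kleene_or] and [kleene_and], as matrix associativity requires. *)
HB.instance Definition _ :=
  Monoid.isComLaw.Build ternary (Some false) kleene_or
    kleene_orA kleene_orC kleene_or0x.

HB.instance Definition _ :=
  Monoid.isMulLaw.Build ternary (Some false) kleene_and
    kleene_and0x kleene_andx0.

HB.instance Definition _ :=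
  Monoid.isAddLaw.Build ternary kleene_and kleene_or
    kleene_andDl kleene_andDr.

(* The consensus term [kleene_and a b] makes the selection hazard-free: *)
(* an unstable selector yields the superposition of [a] and [b].        *)
Definition kleene_mux (s a b : ternary) : ternary :=
  kleene_or (kleene_or (kleene_and (kleene_not s) a) (kleene_and s b))
            (kleene_and a b).

Definition kleene_mulmx (I : finType) (A B : I -> I -> ternary) (i j : I) :
    ternary :=
  \big[kleene_or/Some false]_h kleene_and (A i h) (B h j).

Lemma kleene_mulmxA (I : finType) (A B C : I -> I -> ternary) i j :
  kleene_mulmx A (kleene_mulmx B C) i j = kleene_mulmx (kleene_mulmx A B) C i j.
Proof.
rewrite /kleene_mulmx; under eq_bigr do rewrite big_distrr /=.
rewrite exchange_big /=; apply: eq_bigr => h _.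
by rewrite big_distrl /=; apply: eq_bigr => g _; rewrite kleene_andA.
Qed.

Lemma eq_kleene_mulmx (I : finType) (A A' B B' : I -> I -> ternary) :
  A =2 A' -> B =2 B' -> kleene_mulmx A B =2 kleene_mulmx A' B'.
Proof. by move=> eqA eqB i j; apply: eq_bigr => h _; rewrite eqA eqB. Qed.

Fixpoint prefix_mulmx (I : finType) (M : nat -> I -> I -> ternary) (i : nat) :
    I -> I -> ternary :=
  if i is i'.+1 then kleene_mulmx (prefix_mulmx M i') (M i) else M 0.

(** This is the recursion of the parallel prefix circuit. [prefix_mulmx M i] has [i + 1] factors, so
    the odd index [i.*2.+1] is a prefix of even length, which splits into adjacent pairs. *)
Lemma prefix_mulmx_double (I : finType) (M : nat -> I -> I -> ternary) i :
  prefix_mulmx (fun j => kleene_mulmx (M j.*2) (M j.*2.+1)) i =2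
  prefix_mulmx M i.*2.+1.
Proof.
elim: i => [|i IH] a b //=.
by rewrite kleene_mulmxA; do 2!apply: eq_kleene_mulmx => //.
Qed.

(** * Hazard-free multiplexer trees *)

Fixpoint mux_tree (r p : nat) (g : seq bool -> bool) (X : nat -> ternary) :
    ternary :=
  if r is r'.+1 then
    kleene_mux (X p) (mux_tree r' p.+1 (g \o cons false) X)
                     (mux_tree r' p.+1 (g \o cons true) X)
  else Some (g [::]).

Lemma eq_mux_tree r p g h : (forall z, size z = r -> g z = h z) ->
  mux_tree r p g =1 mux_tree r p h.
Proof.
elim: r p g h => [|r IH] p g h eq_gh X /=; first by rewrite eq_gh.
by congr kleene_mux; apply: IH => z sz_z; apply: eq_gh; rewrite /= sz_z.
Qed.

Definition resolves (X : nat -> ternary) (Y : nat -> bool) : Prop :=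
  forall p b, X p = Some b -> Y p = b.

(** Every branch compatible with [X p] yields [b] by induction. For a stable selector the selected
    branch decides; for an unstable one both branches equal [b], and so does their consensus
    term. *)
Lemma mux_tree_hazard_free r p g X b :
  (forall Y, resolves X Y -> g [seq Y q | q <- iota p r] = b) ->
  mux_tree r p g X = Some b.
Proof.
elim: r p g => [|r IH] p g res_b /=.
  (* Some resolution must be exhibited: every unstable bit is set to 0. *)
  by rewrite (res_b (odflt false \o X)) // => q c /= ->.
have branch c : X p != Some (~~ c) -> mux_tree r p.+1 (g \o cons c) X = Some b.
  move=> Xp; apply: IH => Y resY /=.
  (* Overwriting bit [p] by [c] still resolves [X], and the subtree reads only later positions. *)
  rewrite -(res_b (fun q => if q == p then c else Y q)) /=.
    rewrite eqxx; congr (g (c :: _)); apply/eq_in_map => q.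
    by rewrite mem_iota => /andP[lt_pq _]; rewrite gtn_eqF.
  move=> q e; case: eqP => [->|_]; last exact: resY.
  by move: Xp; case: (X p) => [e'|] // ne [<-]; case: c e' ne => [] [].
move: (branch false) (branch true).
case: (X p) => [[]|] /= eq0 eq1.
- by rewrite eq1 //; case: (b) (mux_tree _ _ _ _) => [] [[]|].
- by rewrite eq0 //; case: (b) (mux_tree _ _ _ _) => [] [[]|].
by rewrite eq0 // eq1 //; case: (b).
Qed.

(** * Building circuits gate by gate *)

Section Building.

Variable N : nat.

Implicit Types (gs hs : seq gate) (F G : (nat -> ternary) -> ternary).

(** Depth labels of all wires, with label 0 on the inputs; they grow with the gate list in the same
    way as the values do, unlike the path-based [circuit_depth]. *)
Definition gate_depths gs : seq nat :=
  foldl (fun ds g => rcons ds (\max_(i <- operands g) nth 0 ds i).+1)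
        (nseq N 0) gs.

Lemma size_eval_gates (v : seq ternary) gs :
  size (eval_gates v gs) = size v + size gs.
Proof.
by elim: gs v => [|g gs IH] v /=; rewrite ?addn0 // IH size_rcons addnS.
Qed.

Lemma eval_gates_rcons (v : seq ternary) gs g :
  eval_gates v (rcons gs g) =
  rcons (eval_gates v gs) (eval_gate (eval_gates v gs) g).
Proof. by rewrite /eval_gates foldl_rcons. Qed.

Lemma gate_depths_rcons gs g :
  gate_depths (rcons gs g) =
  rcons (gate_depths gs) (\max_(i <- operands g) nth 0 (gate_depths gs) i).+1.
Proof. by rewrite /gate_depths foldl_rcons. Qed.

Lemma size_gate_depths gs : size (gate_depths gs) = N + size gs.
Proof.
elim/last_ind: gs => [|gs g IH]; first by rewrite /= size_nseq addn0.
by rewrite gate_depths_rcons !size_rcons IH addnS.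
Qed.

Lemma well_formed_cat w gs hs :
  well_formed w (gs ++ hs) = well_formed w gs && well_formed (w + size gs) hs.
Proof.
elim: gs w => [|g gs IH] w /=; first by rewrite addn0.
by rewrite IH addnS addSn andbA.
Qed.

Lemma nth_eval_gates_cat (x : N.-tuple ternary) gs hs w : w < N + size gs ->
  nth unstable (eval_gates x (gs ++ hs)) w = nth unstable (eval_gates x gs) w.
Proof.
elim/last_ind: hs => [|hs g IH] lt_w; first by rewrite cats0.
rewrite -rcons_cat eval_gates_rcons nth_rcons size_eval_gates size_tuple.
by rewrite size_cat addnA ltn_addr // IH.
Qed.

Lemma nth_gate_depths_cat gs hs w : w < N + size gs ->
  nth 0 (gate_depths (gs ++ hs)) w = nth 0 (gate_depths gs) w.
Proof.
elim/last_ind: hs => [|hs g IH] lt_w; first by rewrite cats0.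
rewrite -rcons_cat gate_depths_rcons nth_rcons size_gate_depths.
by rewrite size_cat addnA ltn_addr // IH.
Qed.

Definition extends (c : nat) gs gs' : Prop :=
  exists hs, [/\ gs' = gs ++ hs, size hs <= c
               & well_formed N gs -> well_formed N gs'].

Definition grows gs gs' : Prop := exists c, extends c gs gs'.

(** The wire number is hidden and the property survives further growth ([available_grows]), so
    constructions compose by the functions they compute. *)
Definition available gs F (d : nat) : Prop :=
  exists w, [/\ w < N + size gs,
    forall x : N.-tuple ternary,
      nth unstable (eval_gates x gs) w = F (nth unstable x)
    & nth 0 (gate_depths gs) w <= d].

Lemma extends_refl gs : extends 0 gs gs.
Proof. by exists [::]; rewrite cats0. Qed.

Lemma extends_trans b c gs1 gs2 gs3 :
  extends b gs1 gs2 -> extends c gs2 gs3 -> extends (b + c) gs1 gs3.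
Proof.
move=> [h2 [-> s2 w2]] [h3 [-> s3 w3]]; exists (h2 ++ h3).
by rewrite catA size_cat leq_add //; split=> // /w2.
Qed.

Lemma extends_leq b c gs gs' : b <= c -> extends b gs gs' -> extends c gs gs'.
Proof. by move=> le_bc [h [? le_h ?]]; exists h; rewrite (leq_trans le_h). Qed.

Lemma extends_grows c gs gs' : extends c gs gs' -> grows gs gs'.
Proof. by exists c. Qed.

Lemma grows_trans gs1 gs2 gs3 : grows gs1 gs2 -> grows gs2 gs3 -> grows gs1 gs3.
Proof. by move=> [b e] [c f]; exists (b + c); exact: extends_trans e f. Qed.

Lemma available_grows gs gs' F d :
  grows gs gs' -> available gs F d -> available gs' F d.
Proof.
move=> [c [h [-> _ _]]] [w [lt_w val_w dep_w]]; exists w.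
split; first by rewrite size_cat addnA ltn_addr.
  by move=> x; rewrite nth_eval_gates_cat.
by rewrite nth_gate_depths_cat.
Qed.

Lemma available_leq gs F d e : d <= e -> available gs F d -> available gs F e.
Proof. by move=> le_de [w [? ? /leq_trans/(_ le_de)]]; exists w. Qed.

Lemma eq_available gs F G d : F =1 G -> available gs F d -> available gs G d.
Proof. by move=> eqFG [w [lt_w E ?]]; exists w; split=> // x; rewrite E. Qed.

Lemma available_input gs p : p < N -> available gs (fun X => X p) 0.
Proof.
move=> lt_p; exists p; split; first by rewrite ltn_addr.
  move=> x; rewrite -(cat0s gs) nth_eval_gates_cat //= addn0 //.
by rewrite -(cat0s gs) nth_gate_depths_cat ?addn0 // nth_nseq lt_p.
Qed.

Lemma extend_gate gs g F d :
  all (fun i => i < N + size gs) (operands g) ->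
  (forall x : N.-tuple ternary,
     eval_gate (eval_gates x gs) g = F (nth unstable x)) ->
  all (fun i => nth 0 (gate_depths gs) i <= d) (operands g) ->
  exists gs', extends 1 gs gs' /\ available gs' F d.+1.
Proof.
move=> ops val_g dep_g; exists (rcons gs g); split.
  exists [:: g]; rewrite cats1; split=> // wf.
  by rewrite -cats1 well_formed_cat wf /= ops.
exists (N + size gs); split; first by rewrite size_rcons addnS.
  move=> x; rewrite eval_gates_rcons nth_rcons size_eval_gates size_tuple.
  by rewrite ltnn eqxx.
rewrite gate_depths_rcons nth_rcons size_gate_depths ltnn eqxx ltnS.
by apply/bigmax_leqP_seq => i ig _; exact: (allP dep_g).
Qed.

Lemma extend_const gs b :
  exists gs', extends 1 gs gs' /\ available gs' (fun _ => Some b) 1.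
Proof. exact: (@extend_gate gs (Const b)). Qed.

Lemma extend_not gs F d : available gs F d ->
  exists gs', extends 1 gs gs' /\
    available gs' (fun X => kleene_not (F X)) d.+1.
Proof.
move=> [w [lt_w val_w dep_w]].
by apply: (@extend_gate gs (Not w)) => /= [|x|]; rewrite ?lt_w ?val_w ?dep_w.
Qed.

Lemma extend_and gs F G d : available gs F d -> available gs G d ->
  exists gs', extends 1 gs gs' /\
    available gs' (fun X => kleene_and (F X) (G X)) d.+1.
Proof.
move=> [v [lt_v val_v dep_v]] [w [lt_w val_w dep_w]].
by apply: (@extend_gate gs (And v w)) => /= [|x|];
  rewrite ?lt_v ?lt_w ?val_v ?val_w ?dep_v ?dep_w.
Qed.

Lemma extend_or gs F G d : available gs F d -> available gs G d ->
  exists gs', extends 1 gs gs' /\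
    available gs' (fun X => kleene_or (F X) (G X)) d.+1.
Proof.
move=> [v [lt_v val_v dep_v]] [w [lt_w val_w dep_w]].
by apply: (@extend_gate gs (Or v w)) => /= [|x|];
  rewrite ?lt_v ?lt_w ?val_v ?val_w ?dep_v ?dep_w.
Qed.

(** The selector is an input wire, of depth 0. The longest chain from the branches is negation
    level, conjunction and two disjunctions, whence the 4. *)
Lemma extend_mux gs S F G d :
  available gs S 0 -> available gs F d -> available gs G d ->
  exists gs', extends 6 gs gs' /\
    available gs' (fun X => kleene_mux (S X) (F X) (G X)) (d + 4).
Proof.
move=> aS aF aG.
have lift1 := fun g g' F' d' e =>
  @available_grows g g' F' d' (@extends_grows 1 _ _ e).
have [g1 [e1 aN]] := extend_not aS.
have le1 : 1 <= d.+1 by [].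
have [g2 [e2 a2]] := extend_and (available_leq le1 aN)
  (available_leq (leqnSn d) (lift1 _ _ _ _ e1 aF)).
have [g3 [e3 a3]] := extend_and
  (available_leq (leq0n d) (lift1 _ _ _ _ e2 (lift1 _ _ _ _ e1 aS)))
  (lift1 _ _ _ _ e2 (lift1 _ _ _ _ e1 aG)).
have [g4 [e4 a4]] := extend_and
  (lift1 _ _ _ _ e3 (lift1 _ _ _ _ e2 (lift1 _ _ _ _ e1 aF)))
  (lift1 _ _ _ _ e3 (lift1 _ _ _ _ e2 (lift1 _ _ _ _ e1 aG))).
have [g5 [e5 a5]] := extend_or
  (lift1 _ _ _ _ e4 (lift1 _ _ _ _ e3 a2))
  (available_leq (leqnSn _) (lift1 _ _ _ _ e4 a3)).
have [g6 [e6 a6]] := extend_or a5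
  (available_leq (leqW (leqnSn _)) (lift1 _ _ _ _ e5 a4)).
exists g6; split; last by rewrite addn4.
exact: extends_trans (extends_trans (extends_trans (extends_trans
  (extends_trans e1 e2) e3) e4) e5) e6.
Qed.

(** * Families, disjunctions, inner products and prefix products *)

Lemma extend_family (I : finType) (B : I -> seq gate -> Prop) c gs :
  (forall i g g', grows g g' -> B i g -> B i g') ->
  (forall i gs', grows gs gs' -> exists gs'', extends c gs' gs'' /\ B i gs'') ->
  exists gs', extends (#|I| * c) gs gs' /\ forall i, B i gs'.
Proof.
move=> growB build.
suff [gs' [ext Bs]] : exists gs', extends (size (enum I) * c) gs gs' /\
    forall i, i \in enum I -> B i gs'.
  by exists gs'; rewrite cardE; split=> // i; apply: Bs; rewrite mem_enum.
elim: (enum I) => [|i s [g1 [e1 b1]]].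
  by exists gs; split=> //; exact: extends_refl.
have [g2 [e2 b2]] := build i g1 (extends_grows e1).
exists g2; split; first by rewrite mulSn addnC; exact: extends_trans e1 e2.
move=> j /predU1P[-> //|/b1]; apply: growB; exact: extends_grows e2.
Qed.

Lemma extend_finType (I : finType) (F : I -> (nat -> ternary) -> ternary) c d gs :
  (forall i gs', grows gs gs' ->
     exists gs'', extends c gs' gs'' /\ available gs'' (F i) d) ->
  exists gs', extends (#|I| * c) gs gs' /\ forall i, available gs' (F i) d.
Proof.
by apply: (@extend_family I (fun i g => available g (F i) d)) => i g g';
  exact: available_grows.
Qed.

(** A binary tree of disjunctions: the list is cut after [2 ^ e] terms, so both pieces have depth at
    most [e]. *)
Lemma extend_bigor (I : eqType) (s : seq I) (F : I -> (nat -> ternary) -> ternary)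
    d e gs :
  0 < size s <= 2 ^ e -> (forall i, i \in s -> available gs (F i) d) ->
  exists gs', extends (size s).-1 gs gs' /\
    available gs' (fun X => \big[kleene_or/Some false]_(i <- s) F i X) (d + e).
Proof.
elim: e s gs => [|e IH] s gs /andP[s_gt0 s_le] av.
  case: s s_gt0 s_le av => [|i []] //= _ _ av; exists gs.
  split; first exact: extends_refl.
  rewrite addn0; apply: eq_available (av i (mem_head _ _)) => X.
  by rewrite big_seq1.
have [s_le'|s_gt] := leqP (size s) (2 ^ e).
  have [|g [eg ag]] := IH s gs _ av; first by rewrite s_gt0.
  by exists g; split=> //; apply: available_leq ag; rewrite leq_add2l.
have e_gt0 : 0 < 2 ^ e by rewrite expn_gt0.
have sz_t : size (take (2 ^ e) s) = 2 ^ e by rewrite size_takel // ltnW.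
have sz_d : size (drop (2 ^ e) s) = size s - 2 ^ e by rewrite size_drop.
have [||g1 [e1 a1]] := IH (take (2 ^ e) s) gs; first by rewrite sz_t e_gt0 /=.
  by move=> i /mem_take; exact: av.
have [||g2 [e2 a2]] := IH (drop (2 ^ e) s) g1.
- by rewrite sz_d subn_gt0 s_gt leq_subLR addnn -mul2n -expnS.
- by move=> i /mem_drop/av; apply: available_grows; exact: extends_grows e1.
have [g3 [e3 a3]] := extend_or (available_grows (extends_grows e2) a1) a2.
exists g3; split.
  apply: extends_leq (extends_trans (extends_trans e1 e2) e3).
  by rewrite sz_t sz_d; lia.
rewrite addnS; apply: eq_available a3 => X.
by rewrite -big_cat cat_take_drop.
Qed.

Lemma extend_dot (I : finType) (F G : I -> (nat -> ternary) -> ternary) d e gs :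
  0 < #|I| <= 2 ^ e ->
  (forall i, available gs (F i) d) -> (forall i, available gs (G i) d) ->
  exists gs', extends (2 * #|I|) gs gs' /\
    available gs'
      (fun X => \big[kleene_or/Some false]_i kleene_and (F i X) (G i X))
      (d + e.+1).
Proof.
move=> le_I aF aG.
have [|g1 [e1 a1]] :=
    @extend_finType I (fun i X => kleene_and (F i X) (G i X)) 1 d.+1 gs.
  by move=> i g' gr; apply: extend_and; [have := aF i | have := aG i];
    apply: available_grows.
have [|//|g2 [e2 a2]] := @extend_bigor I (index_enum I)
    (fun i X => kleene_and (F i X) (G i X)) d.+1 e g1.
  by rewrite /index_enum -enumT -cardE.
exists g2; split; last by rewrite addnS -addSn.
apply: extends_leq (extends_trans e1 e2).
have -> : size (index_enum I) = #|I| by rewrite cardE enumT.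
by rewrite muln1 mul2n -addnn leq_add2l leq_pred.
Qed.

(* Multiplying adjacent pairs and recursing on the products yields the prefixes *)
(* of even length; one more product each yields those of odd length.            *)
Lemma extend_prefix (I : finType)
    (M : nat -> I -> I -> (nat -> ternary) -> ternary) d e E n gs :
  0 < #|I| <= 2 ^ E -> n <= 2 ^ e ->
  (forall i a b, i < n -> available gs (M i a b) d) ->
  exists gs', extends (2 * n * (#|I| ^ 2 * (2 * #|I|))) gs gs' /\
    forall i a b, i < n ->
      available gs' (fun X => prefix_mulmx (fun j a' b' => M j a' b' X) i a b)
        (d + 2 * e * E.+1).
Proof.
move=> le_I; elim: e n M d gs => [|e IH] n M d gs n_le av.
  exists gs; split; first exact: extends_leq (extends_refl _).
  move=> [|i] a b lt_i; last by lia.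
  by apply: available_leq (av 0 a b lt_i); rewrite leq_addr.
have card3 k : #|{: 'I_k * (I * I)}| = k * #|I| ^ 2.
  by rewrite !card_prod card_ord.
have [p gs' gr|g1 [e1 a1]] := @extend_finType ('I_n./2 * (I * I))%type
    (fun p X => kleene_mulmx (fun a b => M p.1.*2 a b X)
                  (fun a b => M p.1.*2.+1 a b X) p.2.1 p.2.2)
    (2 * #|I|) (d + E.+1) gs.
  have lt_p := ltn_ord p.1.
  by apply: extend_dot => // i; apply: available_grows gr (av _ _ _ _); lia.
have [|i a b lt_i|g2 [e2 a2]] := IH n./2 (fun i a b X =>
    kleene_mulmx (fun a b => M i.*2 a b X) (fun a b => M i.*2.+1 a b X) a b)
    (d + E.+1) g1.
- by move: n_le; rewrite expnS; lia.
- exact: a1 (Ordinal lt_i, (a, b)).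
(* Depth of the even-length prefixes: one product for the pairs, then the recursion. The odd-length
   ones cost one product more, so each halving of [n] costs two products in depth. *)
pose D := d + E.+1 + 2 * e * E.+1.
have odd_pre i a b : i < n./2 -> available g2 (fun X =>
    prefix_mulmx (fun j a' b' => M j a' b' X) i.*2.+1 a b) D.
  by move=> lt_i; apply: eq_available (a2 i a b lt_i) => X;
    rewrite -prefix_mulmx_double.
have gr2 : grows gs g2 := grows_trans (extends_grows e1) (extends_grows e2).
have [p gs' gr|g3 [e3 a3]] := @extend_finType ('I_(n.-1)./2 * (I * I))%type
    (fun p X => prefix_mulmx (fun j a' b' => M j a' b' X)
       p.1.*2.+2 p.2.1 p.2.2) (2 * #|I|) (D + E.+1) g2.
  have lt_p := ltn_ord p.1.
  apply: extend_dot => // i.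
    by apply: available_grows gr (odd_pre _ _ _ _); lia.
  apply: available_grows gr (available_grows gr2 _).
  by apply: available_leq (av _ _ _ _); rewrite /D -?addnA ?leq_addr //; lia.
exists g3; split.
  apply: extends_leq (extends_trans (extends_trans e1 e2) e3).
  (* Number of matrix products: [n./2] for the pairs, [2 * n./2] in the recursion and [n.-1./2] for
     the odd lengths, at most [2 * n] in total. *)
  rewrite !card3 -!(mulnA _ (#|I| ^ 2)) -!mulnDl leq_mul2r; apply/orP; right.
  by have := odd_double_half n; have := odd_double_half n.-1; lia.
move=> i a b lt_i.
have -> : d + 2 * e.+1 * E.+1 = D + E.+1 by rewrite /D; lia.
have gr3 := extends_grows e3.
case: i lt_i => [|i] lt_i.
  apply: available_leq (available_grows gr3 (available_grows gr2 (av 0 a b lt_i))).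
  by rewrite /D -!addnA leq_addr.
have := odd_double_half i; case: (odd i) => Ei; last first.
  have -> : i.+1 = i./2.*2.+1 by rewrite -[in LHS]Ei.
  apply: available_grows gr3 _.
  by apply: available_leq (odd_pre _ _ _ _); [rewrite leq_addr | lia].
have -> : i.+1 = i./2.*2.+2 by rewrite -[in LHS]Ei.
have lt_h : i./2 < (n.-1)./2 by move: Ei lt_i; rewrite add1n; lia.
exact: a3 (Ordinal lt_h, (a, b)).
Qed.

(** Only the top [j] levels are built, with [2 ^ j - 1] multiplexers; their leaves are existing
    trees on the last [r] bits. *)
Lemma extend_mux_tree j r p g d gs :
  p + (j + r) <= N -> (forall h, available gs (mux_tree r (p + j) h) d) ->
  exists gs', extends (6 * (2 ^ j).-1) gs gs' /\
    available gs' (mux_tree (j + r) p g) (d + 4 * j).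
Proof.
elim: j p g gs => [|j IH] p g gs le_N base.
  exists gs; split; first exact: extends_leq (extends_refl _).
  by have := base g; rewrite !addn0.
have le_N' : p.+1 + (j + r) <= N by rewrite addSnnS -addSn.
have base' h : available gs (mux_tree r (p.+1 + j) h) d.
  by rewrite addSnnS; exact: base.
have [g1 [e1 a1]] := IH p.+1 (g \o cons false) gs le_N' base'.
have [|g2 [e2 a2]] := IH p.+1 (g \o cons true) g1 le_N'.
  by move=> h; apply: available_grows (base' h); exact: extends_grows e1.
have lt_p : p < N by lia.
have [g3 [e3 a3]] := extend_mux (available_input g2 lt_p)
  (available_grows (extends_grows e2) a1) a2.
exists g3; split; last by rewrite mulnS addnCA [4 + _]addnC.
apply: extends_leq (extends_trans (extends_trans e1 e2) e3).
have := expn_gt0 2 j; rewrite expnS; lia.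
Qed.

(** There are [2 ^ (2 ^ r)] Boolean functions of [r] bits, and each gets a full tree whose leaves
    are the two constants. *)
Lemma extend_all_mux_trees r p gs :
  p + r <= N -> (forall b, available gs (fun _ => Some b) 1) ->
  exists gs', extends (2 ^ (2 ^ r) * (6 * 2 ^ r)) gs gs' /\
    forall h, available gs' (mux_tree r p h) (1 + 4 * r).
Proof.
move=> le_N base; pose restr (h : {ffun r.-tuple bool -> bool}) z :=
  h [tuple nth false z i | i < r].
have [h gs' gr|g1 [e1 a1]] := @extend_finType {ffun r.-tuple bool -> bool}
    (fun h => mux_tree r p (restr h)) (6 * 2 ^ r) (1 + 4 * r) gs.
  have [||g2 [e2 a2]] := @extend_mux_tree r 0 p (restr h) 1 gs'.
  - by rewrite addn0.
  - by move=> f; apply: available_grows gr _; exact: base.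
  exists g2; split; last by rewrite addn0 in a2.
  by apply: extends_leq e2; rewrite leq_mul2l leq_pred.
exists g1; split.
  by rewrite card_ffun card_tuple card_bool in e1.
move=> h; apply: eq_available (a1 [ffun z : r.-tuple bool => h z]) => X.
apply: eq_mux_tree => z /eqP sz_z; rewrite /restr ffunE.
congr h; rewrite [RHS](_ : _ = tval (Tuple sz_z)) //; congr val.
by apply: eq_from_tnth => i; rewrite tnth_mktuple (tnth_nth false).
Qed.

End Building.

(** * Correctness on possible states *)

Section Semantics.

Variables (S : finType) (s0 : S) (t : S -> seq bool -> S) (l : nat).

Definition block (Y : nat -> bool) (i : nat) : seq bool :=
  [seq Y p | p <- iota (i * l) l].

Fixpoint state_at (Y : nat -> bool) (i : nat) : S :=
  if i is i'.+1 then t (state_at Y i') (block Y i') else s0.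

Lemma eq_block Y Z i :
  (forall p, i * l <= p < i.+1 * l -> Y p = Z p) -> block Y i = block Z i.
Proof.
move=> eqYZ; apply/eq_in_map => p; rewrite mem_iota => lt_p.
by apply: eqYZ; rewrite mulSn addnC.
Qed.

Lemma eq_state_at Y Z i :
  (forall p, p < i * l -> Y p = Z p) -> state_at Y i = state_at Z i.
Proof.
elim: i => //= i IH eqYZ; rewrite IH; last first.
  by move=> p lt_p; apply: eqYZ; rewrite mulSn ltn_addl.
by congr t; apply: eq_block => p /andP[_]; exact: eqYZ.
Qed.

Variable K : nat.

(* A function from 'I_K stands for its image, so that these index the *)
(* nonempty sets of at most K states.                                 *)
Notation index := {ffun 'I_K -> S}.

Definition block_forall (Q : S -> seq bool -> bool) (i : nat) (A : index)
    (X : nat -> ternary) : ternary :=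
  mux_tree l (i * l) (fun z => [forall a, Q (A a) z]) X.

Definition transition_mx (i : nat) (A B : index) (X : nat -> ternary) : ternary :=
  block_forall (fun s z => t s z \in codom B) i A X.

(** The row of the singleton of [s0]. Symbols 0 to [i] have been read, so row [i] describes the
    state at time [i + 1]. *)
Definition state_row (i : nat) (B : index) (X : nat -> ternary) : ternary :=
  prefix_mulmx (fun j A B => transition_mx j A B X) i [ffun=> s0] B.

(** The possible states at time [i] are exactly the image of one index, so there are at most [K] of
    them. Both inclusions matter in [block_forall_read]. *)
Definition reached (X : nat -> ternary) (i : nat) : Prop :=
  exists A : index,
    (forall Y, resolves X Y -> state_at Y i \in codom A) /\
    (forall a, exists2 Y, resolves X Y & state_at Y i = A a).

Lemma block_forall_start Q X b : 0 < K ->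
  (forall Y, resolves X Y -> Q s0 (block Y 0) = b) ->
  block_forall Q 0 [ffun=> s0] X = Some b.
Proof.
move=> K_gt0 res_b; apply: mux_tree_hazard_free => Y /res_b <-.
apply/forallP/idP => [/(_ (Ordinal K_gt0))|]; first by rewrite ffunE.
by move=> Q0 a; rewrite ffunE.
Qed.

(** Let [A] be the set of possible states. If [b] is true, the term of [A] is 1. If [b] is false, a
    set meeting [A] contains an attained state on which [Q] surely fails, so its second factor is 0;
    a set disjoint from [A] surely misses the state, so its first factor is 0. *)
Lemma block_forall_read Q (V : index -> ternary) X i b : reached X i ->
  (forall (A : index) c, (forall Y, resolves X Y -> (state_at Y i \in codom A) = c) ->
     V A = Some c) ->
  (forall Y, resolves X Y -> Q (state_at Y i) (block Y i) = b) ->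
  \big[kleene_or/Some false]_A kleene_and (V A) (block_forall Q i A X) = Some b.
Proof.
move=> [A [covA attA]] V_ok res_b.
(* The state depends on bits before [i * l] and the block on later ones, so two resolutions can be
   spliced there. *)
have mix Y Z : resolves X Y -> resolves X Z ->
    Q (state_at Y i) (block Z i) = b.
  move=> resY resZ; rewrite -(res_b (fun p => if p < i * l then Y p else Z p)).
    congr Q; first by apply: eq_state_at => p ->.
    by apply: eq_block => p /andP[le_p _]; rewrite ltnNge le_p.
  by move=> p c Xp; case: ifP => _; [exact: resY Xp | exact: resZ Xp].
case: b res_b mix => res_b mix.
  rewrite (bigD1 A) //= (V_ok _ true) => [|Y /covA //].
  rewrite /block_forall (@mux_tree_hazard_free _ _ _ _ true) => [|Z resZ].
    by case: (bigop _ _ _) => [[]|].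
  by apply/forallP => a; have [Y resY <-] := attA a; exact: mix.
apply: big1 => B _; have [/existsP[a /codomP[c Bc]]|noB] :=
    boolP [exists a, A a \in codom B].
  rewrite /block_forall (@mux_tree_hazard_free _ _ _ _ false) ?kleene_andx0 //.
  move=> Z resZ; apply/negbTE/negP => /forallP/(_ c); rewrite -Bc.
  by have [Y resY <-] := attA a; rewrite mix.
rewrite (V_ok _ false) ?kleene_and0x // => Y resY; apply/negbTE/negP => inB.
have /codomP[a eq_a] := covA Y resY; case/negP: noB.
by apply/existsP; exists a; rewrite -eq_a.
Qed.

Lemma state_row_hazard_free X i (B : index) b : 0 < K ->
  (forall j, j <= i -> reached X j) ->
  (forall Y, resolves X Y -> (state_at Y i.+1 \in codom B) = b) ->
  state_row i B X = Some b.
Proof.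
move=> K_gt0; elim: i B b => [|i IH] B b rch res_b.
  exact: block_forall_start.
apply: (block_forall_read (rch _ (leqnn _))) => [A c|]; last exact: res_b.
by apply: IH => j le_j; apply: rch; exact: leqW.
Qed.

End Semantics.

(** * Circuits and hazard-free extensions *)

Lemma star_stableP x y b : star x y = Some b <-> x = Some b /\ y = Some b.
Proof. by case: x y b => [[]|] [[]|] [] /=; split=> // -[]. Qed.

Lemma superposition_stableP M (s : seq (M.-tuple ternary)) j b : s != [::] ->
  tnth (superposition s) j = Some b <-> {in s, forall y, tnth y j = Some b}.
Proof.
case: s => // y s _; rewrite /superposition /=.
elim: s y => [|z s IH] y /=.
  by split=> [yb z /[1!inE]/eqP-> //|]; apply; rewrite mem_head.
rewrite IH; split=> all_b w; rewrite !in_cons.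
  have := all_b _ (mem_head _ _); rewrite tnth_mktuple star_stableP => -[yb zb].
  case/or3P=> [/eqP->|/eqP->|ws] //; apply: all_b.
  by rewrite in_cons ws orbT.
case/predU1P=> [->|ws]; last by apply: all_b; rewrite !in_cons ws !orbT.
by rewrite tnth_mktuple star_stableP !all_b // !in_cons eqxx ?orbT.
Qed.

Lemma hazard_free_extension_stableP N M (f : N.-tuple bool -> M.-tuple bool) x j b :
  tnth (hazard_free_extension f x) j = Some b <->
  {in resolutions x, forall y, tnth (f y) j = b}.
Proof.
rewrite /hazard_free_extension superposition_stableP; last first.
  have /set0Pn[y yx] := resolutions_neq0 x.
  apply: contraTneq (image_f (fun y => stable (f y)) yx) => ->.
  by rewrite in_nil.
split=> [all_b y yx|all_b _ /imageP[y yx ->]]; last by rewrite tnth_map all_b.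
by have := all_b _ (image_f (fun y => stable (f y)) yx); rewrite tnth_map => -[].
Qed.

Lemma mem_resolutionsP N (x : N.-tuple ternary) (y : N.-tuple bool) :
  reflect (resolves (nth unstable x) (nth false y)) (y \in resolutions x).
Proof.
rewrite inE; apply: (iffP forallP) => [res p b xp|res i].
  have lt_p : p < N.
    by rewrite ltnNge; apply/negP => le_p; rewrite nth_default ?size_tuple in xp.
  have := res (Ordinal lt_p).
  by rewrite tnth_map !(tnth_nth false, tnth_nth unstable) /= xp => /eqP[].
apply/implyP; rewrite tnth_map !(tnth_nth false, tnth_nth unstable) /=.
by case xi: (nth _ x i) => [b|] // _; rewrite (res _ _ xi).
Qed.

Lemma resolution_of_resolves N (x : N.-tuple ternary) Y :
  resolves (nth unstable x) Y ->
  exists2 y : N.-tuple bool, y \in resolutions x &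
    forall p, p < N -> nth false y p = Y p.
Proof.
move=> resY; pose y := [tuple Y p | p < N].
have nth_y p : p < N -> nth false y p = Y p.
  by move=> lt_p; rewrite -[p]/(val (Ordinal lt_p)) -tnth_nth tnth_mktuple.
exists y => //; apply/mem_resolutionsP => p b xp; rewrite nth_y; first exact: resY.
by rewrite ltnNge; apply/negP => le_p; rewrite nth_default ?size_tuple in xp.
Qed.

(** Kleene's information order: [w] may stabilize unstable entries of [v] but keeps the stable
    ones. *)
Definition refines (v w : seq ternary) : Prop :=
  size v = size w /\ forall i b, nth unstable v i = Some b -> nth unstable w i = Some b.

Lemma eval_gates_refines v w gs :
  refines v w -> refines (eval_gates v gs) (eval_gates w gs).
Proof.
elim: gs v w => [|g gs IH] v w // [sz vw]; apply: IH.
split=> [|i b]; first by rewrite !size_rcons sz.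
rewrite !nth_rcons -sz; case: ltngtP => // _; first exact: vw.
case: g => [p q|p q|p|c] //=; try move: (vw p) (vw q).
- case: (nth _ v p) (nth _ v q) => [[]|] [[]|] //= vp vq <-;
  by rewrite ?(vp _ erefl) ?(vq _ erefl) //; case: (nth _ w _) => [[]|].
- case: (nth _ v p) (nth _ v q) => [[]|] [[]|] //= vp vq <-;
  by rewrite ?(vp _ erefl) ?(vq _ erefl) //; case: (nth _ w _) => [[]|].
by move: (vw p); case: (nth _ v p) => [c|] // /(_ c erefl) ->.
Qed.

(* Gates are monotone in the information order, so a stable output is shared *)
(* by all resolutions: only inputs with a stable prescribed output matter.   *)
Lemma bit_hazard_free_stable k N M (C : circuit N M) f :
  (forall (x : N.-tuple ternary) j b, count_mem unstable x <= k ->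
     {in resolutions x, forall y, tnth (f y) j = b} ->
     tnth (eval_circuit C x) j = Some b) ->
  bit_hazard_free k C f.
Proof.
move=> Cf; have impl : implements C f.
  move=> x; apply: eq_from_tnth => j; rewrite [RHS]tnth_map; apply: Cf.
    by rewrite /= count_map (eq_count (a2 := pred0)) ?count_pred0.
  move=> y /mem_resolutionsP res; congr (tnth (f _) j); apply: eq_from_tnth => i.
  by rewrite !(tnth_nth false) (res i (nth false x i)) // (nth_map false) ?size_tuple.
split=> // x le_k; apply: eq_from_tnth => j.
case hfe: (tnth (hazard_free_extension f x) j) => [b|].
  by apply: Cf => //; apply/hazard_free_extension_stableP.
case Cx: (tnth (eval_circuit C x) j) => [b|] //.
rewrite -hfe; apply/esym/hazard_free_extension_stableP => y /mem_resolutionsP res.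
have ref : refines x (stable y).
  split=> [|i c xi]; first by rewrite !size_tuple.
  have lt_i : i < N.
    by rewrite ltnNge; apply/negP => le_i; rewrite nth_default ?size_tuple in xi.
  by rewrite (nth_map false) ?size_tuple // (res _ _ xi).
have : tnth (eval_circuit C (stable y)) j = Some (tnth (f y) j).
  by rewrite impl tnth_map.
move: Cx; rewrite /eval_circuit !tnth_mktuple.
by move=> /(proj2 (eval_gates_refines (gates C) ref)) -> [].
Qed.

(** A resolution is determined by the set of unstable positions at which it is 1. *)
Lemma card_resolutions N (x : N.-tuple ternary) :
  #|resolutions x| <= 2 ^ count_mem unstable x.
Proof.
pose U := [set i | tnth x i == unstable].
have -> : count_mem unstable x = #|U|.
  rewrite -sum1_count big_tuple -sum1_card.
  by apply: eq_bigl => i; rewrite [RHS]in_set.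
rewrite -card_powerset -(card_in_imset (f := fun y => [set i in U | tnth y i])).
  apply/subset_leq_card/subsetP => _ /imsetP[y _ ->].
  by rewrite inE; apply/subsetP => i /[!inE] /andP[].
move=> y z /mem_resolutionsP resy /mem_resolutionsP resz eqU.
apply: eq_from_tnth => i; have [iU|iU] := boolP (i \in U).
  by move/setP/(_ i): eqU; rewrite !in_set -(in_set (fun i => tnth x i == unstable)) iU.
move: iU; rewrite inE (tnth_nth unstable); case xi: (nth _ x i) => [b|] // _.
by rewrite !(tnth_nth false) (resy _ _ xi) (resz _ _ xi).
Qed.

Lemma reached_few_unstable (S : finType) (s0 : S) t l n k
    (x : (l * n).-tuple ternary) i :
  count_mem unstable x <= k -> i <= n ->
  reached s0 t l (2 ^ k) (nth unstable x) i.
Proof.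
move=> le_k le_i; pose st (y : (l * n).-tuple bool) := state_at s0 t l (nth false y) i.
pose P := [set st y | y in resolutions x].
have /set0Pn[y0 y0x] := resolutions_neq0 x.
have P_y0 : st y0 \in P by exact: imset_f.
have leP : #|P| <= 2 ^ k.
  apply: leq_trans (leq_imset_card _ _) (leq_trans (card_resolutions x) _).
  by rewrite leq_exp2l.
(* When fewer than [2 ^ k] states are possible, the surplus entries repeat [st y0]; this default is
   itself attained, so no spurious state enters the image. *)
exists [ffun a : 'I_(2 ^ k) => nth (st y0) (enum P) a]; split=> [Y resY|a].
  have [y yx nth_y] := resolution_of_resolves resY.
  have -> : state_at s0 t l Y i = st y.
    apply: eq_state_at => p lt_p; rewrite nth_y // (leq_trans lt_p) //.
    by rewrite mulnC leq_mul2l le_i orbT.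
  have yP : st y \in enum P by rewrite mem_enum imset_f.
  have lt_y : index (st y) (enum P) < 2 ^ k.
    by apply: leq_trans leP; rewrite cardE index_mem.
  by apply/codomP; exists (Ordinal lt_y); rewrite ffunE nth_index.
have : nth (st y0) (enum P) a \in P.
  have [lt_a|le_a] := ltnP a (size (enum P)); last by rewrite nth_default.
  by rewrite -mem_enum mem_nth.
case/imsetP=> y /mem_resolutionsP resy eq_y.
by exists (nth false y); rewrite ?ffunE.
Qed.

(** * From depth labels and gate lists to circuits *)

Lemma gate_depth_operand N gs g v : well_formed N gs -> g < size gs ->
  v \in operands (nth (Const false) gs g) ->
  nth 0 (gate_depths N gs) v < nth 0 (gate_depths N gs) (N + g).
Proof.
move=> wf lt_g vg; have lt_v := well_formed_nth wf vg.
have sz_t : size (take g gs) = g by rewrite size_takel // ltnW.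
have Dgs : gs = take g gs ++ nth (Const false) gs g :: drop g.+1 gs.
  by rewrite -drop_nth // cat_take_drop.
rewrite [in X in X < _]Dgs nth_gate_depths_cat ?sz_t //.
rewrite [in X in _ < X]Dgs -cat_rcons nth_gate_depths_cat; last first.
  by rewrite size_rcons sz_t addnS.
rewrite gate_depths_rcons nth_rcons size_gate_depths sz_t ltnn eqxx ltnS.
by rewrite (bigmax_sup_seq _ vg).
Qed.

(** Depth labels strictly increase along every wire-to-gate step, so the label of an output bounds
    the number of gates on any path ending there. *)
Lemma circuit_of_available N M gs (F : 'I_M -> (nat -> ternary) -> ternary) d :
  well_formed N gs -> (forall j, available N gs (F j) d) ->
  exists C : circuit N M, [/\ circuit_size C = size gs, circuit_depth C <= d
    & forall x j, tnth (eval_circuit C x) j = F j (nth unstable x)].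
Proof.
move=> wf av.
have /fin_all_exists[w w_ok] : forall j, exists w : 'I_(N + size gs),
    (forall x : N.-tuple ternary,
       nth unstable (eval_gates x gs) w = F j (nth unstable x)) /\
    nth 0 (gate_depths N gs) w <= d.
  by move=> j; have [w [lt_w ? ?]] := av j; exists (Ordinal lt_w).
exists (@Circuit N M gs [tuple w j | j < M] wf); split=> //.
  apply/bigmax_leqP => e /existsP[v /existsP[p /and3P[_ pth out]]].
  have deep : nth 0 (gate_depths N gs) v + size p <= nth 0 (gate_depths N gs) (last v p).
    elim: (tval p) v pth {out} => [|u q IH] v /=; first by rewrite addn0.
    case/andP=> /andP[/= le_u uv] /IH; apply: leq_trans.
    have lt_u : u - N < size gs by rewrite ltn_subLR.
    have := gate_depth_operand wf lt_u uv; rewrite subnKC //.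
    by rewrite addnS -addSn leq_add2r.
  have /mapP[j _ eq_j] : last v p \in [seq w j | j <- enum 'I_M] by [].
  have := proj2 (w_ok j); rewrite -eq_j; apply: leq_trans.
  by apply: leq_trans deep; rewrite size_tuple leq_addl.
by move=> x j; rewrite !tnth_mktuple (proj1 (w_ok j)).
Qed.

(** * Transcription circuits *)

(** Mediates between the lists read by multiplexer trees and the symbols read by the machine; on
    lists of length [l] it keeps all entries. *)
Definition padded (l : nat) (z : seq bool) : l.-tuple bool :=
  [tuple nth false z j | j < l].

Lemma nth_concat m n (z : n.-tuple (m.-tuple bool)) (i : 'I_n) (j : 'I_m) :
  nth false (concat z) (i * m + j) = tnth (tnth z i) j.
Proof. by rewrite -[in RHS](concatK z) !tnth_mktuple. Qed.

Section Transcription.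

Variables (l m : nat) (L : {set m.-tuple bool}).
Variable T : mealy (l.-tuple bool) {b : m.-tuple bool | b \in L}.

Definition padded_transition (s : state T) (z : seq bool) : state T :=
  transition s (padded l z).

Lemma nth_transcribe (a : l.-tuple bool) d s xs i : i < size xs ->
  nth d (transcribe (T := T) s xs) i =
  output (foldl (@transition _ _ T) s (take i xs)) (nth a xs i).
Proof. by elim: xs s i => [|b xs IH] s [|i] //= lt_i; rewrite IH. Qed.

Lemma tnth_symbols n (y : (l * n).-tuple bool) (i : 'I_n) :
  tnth (symbols y) i = padded l (block l (nth false y) i).
Proof.
rewrite tnth_mktuple; apply: eq_from_tnth => j; rewrite !tnth_mktuple.
by rewrite (nth_map 0) ?size_iota // nth_iota.
Qed.

Lemma foldl_transition n (y : (l * n).-tuple bool) i : i <= n ->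
  foldl (@transition _ _ T) (start T) (take i (symbols y)) =
  state_at (start T) padded_transition l (nth false y) i.
Proof.
elim: i => [|i IH] lt_i; first by rewrite take0.
rewrite (take_nth (padded l [::])) ?size_tuple // foldl_rcons IH 1?ltnW //.
by rewrite -(tnth_nth _ _ (Ordinal lt_i)) tnth_symbols.
Qed.

Lemma tnth_boolean_transcription n (y : (l * n).-tuple bool) (q : 'I_(m * n)) :
  tnth (boolean_transcription T y) q =
  nth false
    (val (output (state_at (start T) padded_transition l (nth false y) (q %/ m))
            (padded l (block l (nth false y) (q %/ m))))) (q %% m).
Proof.
have m_gt0 : 0 < m.
  by have := leq_ltn_trans (leq0n _) (ltn_ord q); rewrite muln_gt0 => /andP[].
have lt_i : q %/ m < n by rewrite ltn_divLR // [(n * m)%N]mulnC.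
have lt_j : q %% m < m by rewrite ltn_mod.
rewrite (tnth_nth false) /boolean_transcription {1}(divn_eq q m).
rewrite (nth_concat _ (Ordinal lt_i) (Ordinal lt_j)) tnth_map (tnth_nth false) /=.
pose d := tnth (transcription T (symbols y)) (Ordinal lt_i).
congr (nth _ (tval (val _)) _); rewrite (tnth_nth d).
rewrite [tval (transcription _ _)]/(transcribe (start T) (symbols y)).
rewrite (nth_transcribe (padded l [::])) ?size_tuple // foldl_transition 1?ltnW //.
by rewrite -(tnth_nth _ _ (Ordinal lt_i)) tnth_symbols.
Qed.

End Transcription.

(** * Assembling the prefix product and the outputs *)

Section Construction.

Variables (S J : finType) (s0 : S) (t : S -> seq bool -> S).
Variables (l n K r : nat) (Q : J -> S -> seq bool -> bool).

Notation index := {ffun 'I_K -> S}.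

(** Symbol [i] is read in the state at time [i], which is described by row [i - 1]; for the first
    symbol the state is known to be [s0]. *)
Definition output_bit (i : nat) (j : J) (X : nat -> ternary) : ternary :=
  if i is i'.+1 then
    \big[kleene_or/Some false]_(A : index)
      kleene_and (state_row s0 t l i' A X) (block_forall l (Q j) i A X)
  else block_forall l (Q j) 0 ([ffun=> s0] : index) X.

Lemma output_bit_hazard_free i j X b : 0 < K ->
  (forall i', i' <= i -> reached s0 t l K X i') ->
  (forall Y, resolves X Y -> Q j (state_at s0 t l Y i) (block l Y i) = b) ->
  output_bit i j X = Some b.
Proof.
case: i => [|i] K_gt0 rch res_b; first exact: block_forall_start.
apply: (block_forall_read (rch _ (leqnn _))) => [A c|]; last exact: res_b.
by apply: state_row_hazard_free => // i' le_i; apply: rch; exact: leqW.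
Qed.

Lemma build_output_bits : r <= l ->
  exists gs, [/\ well_formed (l * n) gs,
    size gs <= 2 + n * (2 ^ (2 ^ r) * (6 * 2 ^ r))
      + n * #|{: index}| ^ 2 * (6 * 2 ^ (l - r))
      + n * (#|{: index}| * #|J|) * (6 * 2 ^ (l - r))
      + 2 * n * (#|{: index}| ^ 2 * (2 * #|{: index}|))
      + n * #|J| * (2 * #|{: index}|)
    & forall i j, i < n -> available (l * n) gs (output_bit i j)
        (1 + 4 * l + 3 * (up_log 2 n * (up_log 2 #|{: index}|).+1))].
Proof.
move=> le_rl; pose I := {: index}; pose e := up_log 2 n; pose E := up_log 2 #|I|.
have le_I : 0 < #|I| <= 2 ^ E.
  by rewrite up_logP // andbT; apply/card_gt0P; exists [ffun=> s0].
have [|g0 [e0 a0]] := @extend_finType (l * n) bool (fun b _ => Some b) 1 1 [::].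
  by move=> b g _; exact: extend_const.
have in_block (i : 'I_n) : i * l + l <= l * n.
  by rewrite addnC -mulSn mulnC leq_mul2l ltn_ord orbT.
have [||g1 [e1 a1]] := @extend_family (l * n) 'I_n (fun i g => forall h,
    available (l * n) g (mux_tree r (i * l + (l - r)) h) (1 + 4 * r))
    (2 ^ (2 ^ r) * (6 * 2 ^ r)) g0.
- by move=> i g g' gr av h; exact: available_grows (av h).
- move=> i g gr; apply: extend_all_mux_trees.
    by rewrite -addnA subnK.
  by move=> b; apply: available_grows gr (a0 b).
have build_block g i Q' A : grows (l * n) g1 g -> i < n ->
    exists g', extends (l * n) (6 * 2 ^ (l - r)) g g' /\
      available (l * n) g' (block_forall l Q' i (A : index)) (1 + 4 * l).
  move=> gr lt_i; have := @extend_mux_tree (l * n) (l - r) r (i * l)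
    (fun z => [forall a, Q' (A a) z]) (1 + 4 * r) g.
  rewrite subnK // => -[||g' [e' a']]; first exact: in_block (Ordinal lt_i).
    by move=> h; apply: available_grows gr (a1 (Ordinal lt_i) h).
  exists g'; split.
    by apply: extends_leq e'; rewrite leq_mul2l leq_pred.
  by have -> : 1 + 4 * l = 1 + 4 * r + 4 * (l - r) by lia.
have [p g gr|g2 [e2 a2]] := @extend_finType (l * n) ('I_n * (I * I))%type
    (fun p => transition_mx t l p.1 p.2.1 p.2.2) (6 * 2 ^ (l - r)) (1 + 4 * l) g1.
  exact: build_block.
have gr2 := extends_grows e2.
have [p g gr|g3 [e3 a3]] := @extend_finType (l * n) ('I_n * (I * J))%type
    (fun p => block_forall l (Q p.2.2) p.1 p.2.1) (6 * 2 ^ (l - r)) (1 + 4 * l) g2.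
  by apply: build_block => //; apply: grows_trans gr2 gr.
have gr3 := extends_grows e3.
have [|i A B lt_i|g4 [e4 a4]] := @extend_prefix (l * n) I
    (fun i A B => transition_mx t l i A B) (1 + 4 * l) e E n g3 le_I.
- by rewrite up_logP.
- exact: available_grows gr3 (a2 (Ordinal lt_i, (A, B))).
have gr4 := extends_grows e4.
pose D := 1 + 4 * l + 3 * (e * E.+1).
have [p g gr|g5 [e5 a5]] := @extend_finType (l * n) ('I_n * J)%type
    (fun p => output_bit p.1 p.2) (2 * #|I|) D g4.
  have avQ i (A : index) : i < n -> available (l * n) g
      (block_forall l (Q p.2) i A) (1 + 4 * l).
    move=> lt_i; apply: available_grows gr (available_grows gr4 _).
    exact: a3 (Ordinal lt_i, (A, p.2)).
  case: p => -[[|i] lt_i] j /= in avQ *.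
    exists g; split; first exact: extends_leq (extends_refl _ _).
    by apply: available_leq (avQ 0 _ lt_i); rewrite leq_addr.
  have [||g' [e' a']] := @extend_dot (l * n) I
      (fun A X => state_row s0 t l i A X)
      (fun A X => block_forall l (Q j) i.+1 A X)
      (1 + 4 * l + 2 * e * E.+1) E g le_I.
  - by move=> A; apply: available_grows gr (a4 i _ A (ltnW lt_i)).
  - by move=> A; apply: available_leq (avQ _ A lt_i); rewrite leq_addr.
  exists g'; split=> //; apply: available_leq a'.
  (* A second symbol exists here, so [e] is positive and the final inner product of depth [E.+1] is
     absorbed into [e * E.+1]. Thus no term in [E] alone remains when [n] is 1 and the logarithm of
     [n] vanishes. *)
  have e_gt0 : 0 < e by rewrite up_log_gt0 /= (leq_trans _ lt_i).
  rewrite /D -addnA leq_add2l [3 * _]mulSn -mulnA addnC leq_add2r.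
  by rewrite leq_pmull.
exists g5.
have [hs [/= Dg sz wf]] := extends_trans (extends_trans (extends_trans
  (extends_trans (extends_trans e0 e1) e2) e3) e4) e5.
split; [exact: wf| |by move=> i j lt_i; exact: a5 (Ordinal lt_i, j)].
move: sz; rewrite -Dg !card_prod !card_ord card_bool mulnA.
by rewrite -/I; congr (_ <= _); lia.
Qed.

End Construction.

(** * Size and depth estimates *)

Import Order.TTheory GRing.Theory Num.Theory.

Lemma leq_sqr_exp2 a : a ^ 2 <= 2 * 2 ^ a.
Proof.
case: a => [|[|[|a]]] //; elim: a => [//|a]; rewrite [2 ^ a.+4]expnS -!mulnn; lia.
Qed.

(* About log2 l - 1: then 2^(2^r) is at most 2^(l/2), so that computing all *)
(* functions of the last r bits costs no more than O(2^l / l).              *)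
Definition shared_bits (l : nat) : nat := (trunc_log 2 l).-1.

Lemma shared_bits_le l : shared_bits l <= l.
Proof.
rewrite /shared_bits (leq_trans (leq_pred _)) //.
case: l => // l; apply: leq_trans (trunc_logP (isT : 1 < 2) (ltn0Sn l)).
by rewrite ltnW // ltn_expl.
Qed.

(** After cancelling the common power, this is [l] below 2 to the power [(trunc_log 2 l).+1], an
    exponent at most [shared_bits l + 2]. *)
Lemma selecting_muxes_le l : 0 < l ->
  2 ^ (l - shared_bits l) * l <= 4 * 2 ^ l.
Proof.
move=> l_gt0.
have -> : 2 ^ l = 2 ^ (l - shared_bits l) * 2 ^ shared_bits l.
  by rewrite -expnD subnK // shared_bits_le.
rewrite mulnCA.
rewrite leq_mul2l; apply/orP; right.
apply: leq_trans (ltnW (trunc_log_ltn l (isT : 1 < 2))) _.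
by rewrite -[4]/(2 ^ 2) -expnD leq_exp2l // /shared_bits; lia.
Qed.

Lemma shared_muxes_le l : 0 < l ->
  2 ^ (2 ^ shared_bits l) * 2 ^ shared_bits l * l <= 4 * 2 ^ l.
Proof.
(* For [l = 1] the predecessor in [shared_bits] truncates and [2 * q <= l] fails, so this case is
   computed directly. *)
move=> l_gt0; have [l_le1|l_gt1] := leqP l 1.
  by have -> : l = 1 by [lia]; rewrite /shared_bits trunc_log1.
set q := 2 ^ shared_bits l.
have q_le : 2 * q <= l.
  rewrite -expnS prednK; first exact: trunc_logP.
  by rewrite trunc_log_gt0.
(* Cancelling [2 ^ q] leaves [q * (a + q)] to bound by [4 * 2 ^ a]; since [q <= a], it is at most
   [2 * a ^ 2]. *)
pose a := l - q; have -> : l = a + q by rewrite /a; lia.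
rewrite expnD mulnA [_ * 2 ^ q]mulnC -mulnA leq_mul2l; apply/orP; right.
apply: leq_trans (_ : 2 * a ^ 2 <= _).
  by rewrite -mulnn mulnA [2 * a * a]mulnC leq_mul // /a; lia.
by have := leq_sqr_exp2 a; lia.
Qed.

Lemma log2_ge1 (R : realType) (x : R) : (2 <= x)%R -> (1 <= log2 x)%R.
Proof.
move=> x_ge2; have ln2_gt0 : (0 < ln (2 : R))%R by rewrite ln_gt0 // ltr1n.
rewrite /log2 ler_pdivlMr // mul1r ler_ln ?posrE //.
exact: lt_le_trans x_ge2.
Qed.

Lemma log2_exp (R : realType) (x : R) n : (0 < x)%R ->
  log2 (x ^+ n)%R = (n%:R * log2 x)%R.
Proof. by move=> x_gt0; rewrite /log2 lnXn // [RHS]mulrA mulr_natl. Qed.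

(** Rounding up adds at most 1, and 1 is at most the logarithm itself because [n] is at least 2. *)
Lemma up_log_le_log2 (R : realType) n : 1 < n ->
  ((up_log 2 n)%:R <= 2 * log2 (n%:R : R))%R.
Proof.
move=> n_gt1; have ln2_gt0 : (0 < ln (2 : R))%R by rewrite ln_gt0 // ltr1n.
have n_ge2 : (2 <= n%:R :> R)%R by rewrite ler_nat.
have ge1 := log2_ge1 n_ge2.
have : ((up_log 2 n).-1%:R <= log2 (n%:R : R))%R.
  rewrite /log2 ler_pdivlMr // mulr_natl -lnXn //.
  rewrite ler_ln ?posrE ?exprn_gt0 ?ltr0n //; last by lia.
  by rewrite -natrX ler_nat ltnW // up_log_gtn.
have e_gt0 : 0 < up_log 2 n by rewrite up_log_gt0.
by rewrite -[in X in _ -> X](prednK e_gt0) -addn1 natrD; lra.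
Qed.

(** The source of [lambda]: output positions that compute the same Boolean function of state and
    symbol can share one circuit. *)
Lemma card_output_functions (S : finType) l m (f : S -> l.-tuple bool -> m.-tuple bool) :
  #|[set [ffun p : S * l.-tuple bool => tnth (f p.1 p.2) j] | j : 'I_m]| <=
  minn m (2 ^ (#|S| * #|{: l.-tuple bool}|)).
Proof.
rewrite leq_min; apply/andP; split.
  by rewrite -[m in _ <= m]card_ord; exact: leq_imset_card.
by rewrite (leq_trans (max_card _)) // card_ffun card_bool card_prod.
Qed.

Lemma transcription_circuit (k l m n : nat) (L : {set m.-tuple bool})
    (T : mealy (l.-tuple bool) {b : m.-tuple bool | b \in L}) :
  0 < l -> 0 < n ->
  let r := shared_bits l in
  let x := #|state T| ^ 2 ^ k in
  let lambda := minn m (2 ^ (#|state T| * #|{: l.-tuple bool}|)) in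
  exists C : circuit (l * n) (m * n),
    [/\ bit_hazard_free k C (boolean_transcription T (n := n)),
        circuit_size C <= 2 + n * (2 ^ (2 ^ r) * (6 * 2 ^ r))
          + n * x ^ 2 * (6 * 2 ^ (l - r)) + n * (x * lambda) * (6 * 2 ^ (l - r))
          + 2 * n * (x ^ 2 * (2 * x)) + n * lambda * (2 * x)
      & circuit_depth C <= 1 + 4 * l + 3 * (up_log 2 n * (up_log 2 x).+1)].
Proof.
move=> l_gt0 n_gt0 r x lambda.
pose f s a : m.-tuple bool := val (output (m := T) s a).
pose Phi := [set [ffun p : state T * l.-tuple bool => tnth (f p.1 p.2) j] | j : 'I_m].
have Phi_le : #|Phi| <= lambda := card_output_functions f.
pose Q (phi : {phi | phi \in Phi}) s z := val phi (s, padded l z).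
have [gs [wf sz av]] := @build_output_bits (state T) {phi | phi \in Phi} (start T)
  (@padded_transition _ _ _ T) l n (2 ^ k) r Q (shared_bits_le l).
rewrite card_ffun card_ord -/x card_sig in sz av.
have m_gt0 (q : 'I_(m * n)) : 0 < m.
  by have := leq_ltn_trans (leq0n _) (ltn_ord q); rewrite muln_gt0 => /andP[].
have lt_i (q : 'I_(m * n)) : q %/ m < n by rewrite ltn_divLR ?(m_gt0 q) // [(n * m)%N]mulnC.
have PhiP (q : 'I_(m * n)) :
    [ffun p : state T * l.-tuple bool => nth false (f p.1 p.2) (q %% m)] \in Phi.
  have lt_j : q %% m < m by rewrite ltn_mod (m_gt0 q).
  apply/imsetP; exists (Ordinal lt_j) => //.
  by apply/ffunP => p; rewrite !ffunE (tnth_nth false).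
pose F (q : 'I_(m * n)) := output_bit (start T) (@padded_transition _ _ _ T) l (2 ^ k) Q
  (q %/ m) (exist (fun phi => phi \in Phi) _ (PhiP q)).
have avF q := av _ _ (lt_i q) : available (l * n) gs (F q) _.
have [C [szC depC evalC]] := circuit_of_available wf avF.
exists C; split=> //.
  apply: bit_hazard_free_stable => X q b le_k res_b; rewrite evalC.
  apply: output_bit_hazard_free => [|i le_i|Y resY].
  - by rewrite expn_gt0.
  - by apply: reached_few_unstable le_k _; exact: leq_trans le_i (ltnW (lt_i q)).
  have [y yX nth_y] := resolution_of_resolves resY.
  have in_block p : p < (q %/ m).+1 * l -> p < l * n.
    by move=> lt_p; rewrite (leq_trans lt_p) // mulnC leq_mul2l lt_i orbT.
  rewrite /Q /= ffunE /= -(res_b y yX) tnth_boolean_transcription.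
  congr (nth _ (tval (f _ (padded _ _))) _).
    apply: eq_state_at => p lt_p; rewrite nth_y // in_block //.
    by rewrite (leq_trans lt_p) // leq_mul2r leqnSn orbT.
  by apply: eq_block => p /andP[_ lt_p]; rewrite nth_y // in_block.
rewrite szC; apply: leq_trans sz _; rewrite !leq_add //.
  by rewrite !(leq_mul2r, leq_mul2l) Phi_le !orbT.
by rewrite !(leq_mul2r, leq_mul2l) Phi_le !orbT.
Qed.

Theorem corollary1p9 (R : realType) :
  exists c : R,
    forall (k l m n : nat), 0 < l -> 0 < m -> 0 < n ->
    forall (L : {set m.-tuple bool})
           (T : mealy (l.-tuple bool) {b : m.-tuple bool | b \in L}),
    2 ^ k < #|state T| ->
    let lambda := minn m (2 ^ (#|state T| * #|{: l.-tuple bool}|)) in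
    exists C : circuit (l * n) (m * n),
      [/\ bit_hazard_free k C (boolean_transcription T (n := n)),
          ((circuit_size C)%:R <=
             c * ((#|state T|%:R ^+ (3 * 2 ^ k)
                   + 2 ^+ l / l%:R * #|state T|%:R ^+ (2 * 2 ^ k)
                   + 2 ^+ l * #|state T|%:R ^+ (2 ^ k) * lambda%:R) * n%:R))%R
        & ((circuit_depth C)%:R <=
             c * (2 ^+ k * log2 #|state T|%:R * log2 n%:R + l%:R))%R].
Proof.
(* The largest coefficient is that of the middle size term: 6 gates per multiplexer times the factor
   4, once for the shared trees and once for the matrix entries. *)
exists 48%R => k l m n l_gt0 _ n_gt0 L T S_gt lambda.
have [C [hfC szC depC]] := transcription_circuit k T l_gt0 n_gt0.
exists C; split=> //.
  move: szC; rewrite -(ler_nat R) => /le_trans; apply.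
  have l_gt0' : (0 < l%:R :> R)%R by rewrite ltr0n.
  have muxes a : a * l <= 4 * 2 ^ l -> (a%:R <= 4 * (2 ^+ l / l%:R) :> R)%R.
    by rewrite mulrA ler_pdivlMr // -natrX -!natrM ler_nat.
  have := muxes _ (selecting_muxes_le l_gt0).
  have := muxes _ (shared_muxes_le l_gt0).
  have : ((2 ^ (l - shared_bits l))%:R <= 2 ^+ l :> R)%R.
    by rewrite -natrX ler_nat leq_exp2l // leq_subr.
  have : (1 <= 2 ^+ l :> R)%R by apply: exprn_ege1; rewrite ler1n.
  have : (1 <= #|state T|%:R ^+ (2 ^ k) :> R)%R.
    by apply: exprn_ege1; rewrite ler1n (leq_ltn_trans _ S_gt).
  rewrite [3 * 2 ^ k]mulnC [2 * 2 ^ k]mulnC !exprM -/lambda.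
  have : (1 <= n%:R :> R)%R by rewrite ler1n.
  have : (0 <= lambda%:R :> R)%R by rewrite ler0n.
  have : (0 <= 2 ^+ l / l%:R :> R)%R by rewrite divr_ge0 ?exprn_ge0.
  rewrite !(natrD, natrM, natrX) -/lambda.
  rewrite [(2 ^+ (2 ^ _) * (6 * _))%R]mulrCA.
  set x := (#|state T|%:R ^+ (2 ^ k))%R; set P := (2 ^+ l)%R; set q := (P / _)%R.
  set U := (2 ^+ (l - _))%R; set B := (2 ^+ (2 ^ _) * _)%R.
  clearbody B U q P x.
  move=> q_ge0 lam_ge0 n_ge1 x_ge1 P_ge1 leUP leB leU.
  have x2_ge1 : (1 <= x ^+ 2)%R by apply: exprn_ege1.
  have x3_ge1 : (1 <= x ^+ 3)%R by apply: exprn_ege1.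
  have n_ge0 : (0 <= n%:R :> R)%R by lra.
  have xlam_ge0 : (0 <= x * lambda%:R)%R by rewrite mulr_ge0 //; lra.
  have h1 : (1 <= n%:R * x ^+ 3)%R by apply: mulr_ege1.
  have h2 : (n%:R * B <= n%:R * (4 * q * x ^+ 2))%R.
    rewrite ler_wpM2l // (le_trans leB) // -[leLHS]mulr1 ler_wpM2l //; lra.
  have h3 : (n%:R * (x ^+ 2 * U) <= n%:R * (x ^+ 2 * (4 * q)))%R.
    by rewrite !ler_wpM2l //; lra.
  have h4 : (n%:R * (x * lambda%:R * U) <= n%:R * (x * lambda%:R * P))%R.
    by rewrite !ler_wpM2l.
  have h5 : (n%:R * (x * lambda%:R * 1) <= n%:R * (x * lambda%:R * P))%R.
    by rewrite !ler_wpM2l.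
  have h6 : (0 <= n%:R * x ^+ 3)%R by lra.
  have h7 : (0 <= n%:R * (q * x ^+ 2))%R by rewrite !mulr_ge0 //; lra.
  have h8 : (0 <= n%:R * (x * lambda%:R * P))%R by rewrite !mulr_ge0 //; lra.
  by lra.
move: depC; rewrite -(ler_nat R) => /le_trans; apply.
have S_ge2 : (2 <= #|state T|%:R :> R)%R.
  by rewrite ler_nat (leq_ltn_trans _ S_gt) // expn_gt0.
have sigma_ge1 := log2_ge1 S_ge2.
have K_ge1 : (1 <= 2 ^+ k :> R)%R by apply: exprn_ege1; rewrite ler1n.
have l_ge1 : (1 <= l%:R :> R)%R by rewrite ler1n.
(* For [n = 1] both [up_log 2 n] and [log2 n] vanish, and only the depth of the multiplexer trees is
   left. *)
have [n_le1|n_gt1] := leqP n 1.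
  have -> : n = 1 by lia.
  by rewrite up_log1 mul0n muln0 addn0 /log2 ln1 mul0r mulr0 add0r natrD natrM; lra.
have e_le := up_log_le_log2 R n_gt1.
have nu_ge1 : (1 <= log2 (n%:R : R))%R by apply: log2_ge1; rewrite ler_nat.
have x_gt1 : 1 < #|state T| ^ 2 ^ k.
  rewrite (leq_trans (leq_ltn_trans _ S_gt)) ?expn_gt0 //.
  by rewrite -[leqLHS]expn1 leq_pexp2l ?expn_gt0 // (leq_ltn_trans _ S_gt).
have := up_log_le_log2 R x_gt1.
rewrite natrX log2_exp; last by rewrite (lt_le_trans _ S_ge2).
rewrite natrX => E_le.
set w := (2 ^+ k * log2 #|state T|%:R)%R in E_le *.
have w_ge1 : (1 <= w)%R by apply: mulr_ege1.
rewrite !(natrD, natrM) -addn1 natrD.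
(* The second factor is at most [2 * w + 1], hence at most [3 * w] because [w] is at least 1. *)
have : ((up_log 2 n)%:R * ((up_log 2 (#|state T| ^ 2 ^ k))%:R + 1)
        <= 2 * log2 (n%:R : R) * (3 * w))%R.
  by apply: ler_pM; rewrite ?addr_ge0 ?ler0n //; lra.
have : (0 <= w * log2 (n%:R : R))%R by rewrite mulr_ge0 //; lra.
by lra.
Qed.
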